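(* For every integer $m\ge2$ there exist constants $\alpha_m,\beta_m$ depending only on $m$ such that $\frac12<\alpha_m<\beta_m<1$ and, for every $n\ge 1$ with $N=m^n$ and $\sigma_n\sim\mathrm{Unif}(B_n^{(m)})$, \[ N^{\alpha_m}\le\mathbb E\,L(\sigma_n)\le N^{\beta_m}, \] and moreover $\alpha_m=1-o_m(1)$ (i.e. $\alpha_m\to1$ as $m\to\infty$).
   Context: $L(\sigma)$ denotes the length of the longest increasing subsequence of a permutation $\sigma$, i.e. the largest $k$ for which there are $i_1<\dots<i_k$ with $\sigma(i_1)<\dots<\sigma(i_k)$. For permutations, $\oplus$ and $\otimes$ are defined via permutation matrices ($P_\sigma\mathbf e_k=\mathbf e_{\sigma(k)}$): $P_{\sigma\oplus\tau}=P_\sigma\oplus P_\tau$ (block diagonal) and $P_{\sigma\otimes\tau}=P_\sigma\otimes P_\tau$ (Kronecker product); $1_k$ is the identity of $S_k$. Let $\tau_m=(1\ 2\ \cdots\ m)\in S_m$. The group $B_n^{(m)}\subset S_{m^n}$ of nonsimple $m$-nary butterfly permutations is defined by $B_1^{(m)}=\langle\tau_m\rangle$ and, for $n\ge2$, $B_n^{(m)}=\{(\sigma_\theta\otimes1_{m^{n-1}})(\sigma_1\oplus\cdots\oplus\sigma_m):\sigma_\theta\in\langle\tau_m\rangle,\ \sigma_j\in B_{n-1}^{(m)}\}$ (an $n$-fold iterated wreath product of the cyclic group of order $m$). *)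

(* Defs.v *)
From HB Require Import structures.
From mathcomp Require Import all_boot all_order all_algebra all_fingroup.
From mathcomp Require Import mxtens.
From mathcomp Require Import all_classical all_reals all_analysis.

Set Implicit Arguments.
Unset Strict Implicit.
Unset Printing Implicit Defensive.
Import Order.TTheory GRing.Theory Num.Theory.
Import numFieldNormedType.Exports.
Local Open Scope ring_scope.

(* [t] lists the positions of the subsequence in increasing order; the bound
   [k <= N] is no restriction, as such positions are pairwise distinct. *)
Definition has_incr_subseq N (s : 'S_N) (k : nat) : bool :=
  [exists t : k.-tuple 'I_N,
     sorted (fun i j : 'I_N => (i < j)%N) t &&
     sorted (fun i j : 'I_N => (i < j)%N) (map s t)].

Definition lis N (s : 'S_N) : nat :=
  (\max_(k < N.+1 | has_incr_subseq s k) k)%N.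

(* MathComp's [perm_mx s] acts on row vectors, hence the inverse: column [k]
   of [permmat s] is the basis vector indexed by [s k] (see [permmatE]). *)
Definition permmat (R : pzSemiRingType) n (s : 'S_n) : 'M[R]_n :=
  perm_mx s^-1%g.

Lemma permmatE (R : pzSemiRingType) n (s : 'S_n) (k : 'I_n) :
  permmat R s *m (delta_mx k 0 : 'cV[R]_n) = delta_mx (s k) 0.
Proof.
apply/matrixP => i j; rewrite /permmat -row_permE !mxE.
by rewrite (canF_eq (permKV s)).
Qed.

(* [mxtens_index (i, j) : 'I_(m * k)] has value [i * k + j]. *)
Definition osum_fun m k (s : 'I_m -> 'S_k) (x : 'I_(m * k)) : 'I_(m * k) :=
  let ij := mxtens_unindex x in mxtens_index (ij.1, s ij.1 ij.2).

Lemma osum_inj m k (s : 'I_m -> 'S_k) : injective (osum_fun s).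
Proof.
apply: (@can_inj _ _ _ (osum_fun (fun i => (s i)^-1%g))) => x.
case: (mxtens_indexP x) => i j.
by rewrite /osum_fun !mxtens_indexK /= permK.
Qed.

(* s_0 (+) ... (+) s_(m-1), for summands of the same degree k *)
Definition osum m k (s : 'I_m -> 'S_k) : 'S_(m * k) := perm (@osum_inj m k s).

Definition otens_fun m k (s : 'S_m) (t : 'S_k) (x : 'I_(m * k)) : 'I_(m * k) :=
  let ij := mxtens_unindex x in mxtens_index (s ij.1, t ij.2).

Lemma otens_inj m k (s : 'S_m) (t : 'S_k) : injective (otens_fun s t).
Proof.
apply: (@can_inj _ _ _ (otens_fun s^-1%g t^-1%g)) => x.
case: (mxtens_indexP x) => i j.
by rewrite /otens_fun !mxtens_indexK /= !permK.
Qed.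

Definition otens m k (s : 'S_m) (t : 'S_k) : 'S_(m * k) :=
  perm (@otens_inj m k s t).

(* [osum] and [otens] are the permutations characterised by
   P_(s (+) t) = P_s (+) P_t and P_(s (x) t) = P_s (x) P_t. *)
Lemma permmat_osum (R : pzSemiRingType) m k (s : 'I_m -> 'S_k)
    (e : (\sum_(i < m) k)%N = (m * k)%N) :
  permmat R (osum s) = castmx (e, e) (\mxdiag_(i < m) permmat R (s i)).
Proof.
have castE i j :
    cast_ord (esym e) (mxtens_index (i, j)) = tagnat.Rank (p_ := fun=> k) i j.
  apply: val_inj; rewrite [RHS]tagnat.RankEsum /= sum_nat_const; congr (_ * _ + _)%N.
  rewrite -sum1_card -(big_ord_widen _ (fun=> 1%N)) ?sum1_card ?card_ord //.
  exact: ltnW.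
apply/matrixP => x y.
case: (mxtens_indexP x) => i j; case: (mxtens_indexP y) => i' j'.
rewrite castmxE !castE.
rewrite (_ : mxdiag _ _ _ = submxblock (mxdiag (fun i => permmat R (s i))) i i' j j');
  last by rewrite [RHS]mxE.
rewrite mxblockK /permmat !mxE !(canF_eq (permKV _)) permE /osum_fun.
rewrite !mxtens_indexK /= (can_eq (@mxtens_indexK m k)) xpair_eqE.
case: (i =P i') => [<-|nii']; last by rewrite mxE; case: eqP => // /esym.
by rewrite conform_mx_id !mxE (canF_eq (permKV _)).
Qed.

Lemma permmat_otens (R : pzRingType) m k (s : 'S_m) (t : 'S_k) :
  permmat R (otens s t) = tensmx (permmat R s) (permmat R t).
Proof.
apply/matrixP => x y.
case: (mxtens_indexP x) => i j; case: (mxtens_indexP y) => i' j'.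
rewrite tensmxE /permmat !mxE !(canF_eq (permKV _)) permE /otens_fun.
rewrite !mxtens_indexK /= (can_eq (@mxtens_indexK m k)) xpair_eqE mulr_natl mulrb.
by case: eqP => //=; case: eqP.
Qed.

(* The cycle (1 2 ... m), acting on {0, ..., m-1} as i |-> i + 1 mod m. *)
Definition cyc m : 'S_m := perm (@ordS_inj m).

(* In MathComp [(s * t)%g] applies [s] first: the product below is the map
   composition (c (x) 1) o (f_0 (+) ... (+) f_(m-1)). *)
Definition butterfly_step m p (B : {set 'S_(m ^ p)}) : {set 'S_(m ^ p.+1)} :=
  [set cast_perm (esym (expnS m p)) (osum f * otens c 1)%g
     | c : 'S_m in <[cyc m]>%g,
       f : {ffun 'I_m -> 'S_(m ^ p)} in ffun_on (mem B)].

(* The case [n = 0] is a placeholder: the recursion starts at [n = 1], where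
   [m ^ 1] is convertible to [m]. *)
Fixpoint butterfly (m n : nat) : {set 'S_(m ^ n)} :=
  match n with
  | 0 => [set 1%g]
  | p.+1 =>
      match p return {set 'S_(m ^ p)} -> {set 'S_(m ^ p.+1)} with
      | 0 => fun=> <[cyc m]>%g
      | _.+1 => @butterfly_step m _
      end (butterfly m p)
  end.

Lemma butterfly1 m : butterfly m 1 = <[cyc m]>%g.
Proof. by []. Qed.

Lemma butterflySS m n :
  butterfly m n.+2 = butterfly_step (butterfly m n.+1).
Proof. by []. Qed.

Lemma butterflyP m n (s : 'S_(m ^ n.+2)) :
  reflect
    (exists c : 'S_m, exists f : 'I_m -> 'S_(m ^ n.+1),
       [/\ c \in <[cyc m]>%g, (forall i, f i \in butterfly m n.+1) &
           s = cast_perm (esym (expnS m n.+1)) (osum f * otens c 1)%g])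
    (s \in butterfly m n.+2).
Proof.
apply: (iffP imset2P) => [[c f cc /ffun_onP fB ->]|[c [f [cc fB ->]]]].
  by exists c, f.
exists c [ffun i => f i] => //; first by apply/ffun_onP => i; rewrite ffunE.
congr (cast_perm _ (_ * _)%g); apply/permP => x.
by rewrite !permE /osum_fun ffunE.
Qed.

Definition unif_mean (R : realType) (T : finType) (A : {set T}) (X : T -> nat)
    : R :=
  (\sum_(s in A) (X s)%:R) / #|A|%:R.

(* Main.v *)
Require Import Defs.
From mathcomp Require Import all_boot all_order all_algebra all_fingroup.
From mathcomp Require Import all_classical all_reals all_analysis.
From mathcomp Require Import mxtens zify ring lra.
Import Order.TTheory GRing.Theory Num.Theory.
Import numFieldNormedType.Exports.
Set Implicit Arguments.
Unset Strict Implicit.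
Unset Printing Implicit Defensive.

(** Fix m and let X_n be the longest increasing subsequence length of a uniform
element of the n-th butterfly group. Such an element permutes m blocks by the
k-th power of the m-cycle, k uniform, and acts inside the blocks by independent
uniform elements of the previous group.

The k-th power of the m-cycle has two increasing runs, the first m - k
positions and the last k, and every value on the first run exceeds every value
on the second. An increasing subsequence of the big permutation therefore lives
in the blocks of one run ([incr_cycX_sub]), and within a run the blocks can be
treated separately ([lis_inflate]): with independent copies Y_i of X_n,
the variable X_(n+1) is the maximum of the sums of the Y_i over the two runs.

Lower bound: keep the first run only. Taking expectations,
E X_(n+1) is at least the mean of m - k times E X_n, that is
(m + 1)/2 E X_n ([mean_lis_ge]). Hence E X_n is at least ((m + 1)/2)^n,
which is N^alpha for alpha = ln ((m + 1)/2) / ln m; this exceeds 1/2 because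
(m + 1)^2 > 4 m, and 1 - alpha is at most ln 2 / ln m.

Upper bound: the expectation of a maximum is not controlled by expectations
alone, but second moments suffice. Bounding the square of the maximum by the
sum of the squares and applying Cauchy-Schwarz in each run,
E X_(n+1)^2 is at most the mean of (m - k)^2 + k^2 times E X_n^2, that is
(2 m^2 + 1)/3 E X_n^2 ([mean_lis_sqr_le]). The factor is smaller than m^2, so
E X_n <= (E X_n^2)^(1/2) gives an exponent beta < 1.

All recursions start at n = 1, which is the inductive step applied to
summands of length 1: this is why the runs are analysed for arbitrary
weights. *)

(** * Increasing sets of positions *)

Definition incr N (s : 'S_N) (A : {set 'I_N}) : bool :=
  [forall i in A, forall j in A, (i < j) ==> (s i < s j)].

(** Weights are what makes the longest increasing subsequence compatible with
inflation: a block counts for the length that it contributes. *)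
Definition wlis N (s : 'S_N) (w : 'I_N -> nat) : nat :=
  \max_(A : {set 'I_N} | incr s A) \sum_(i in A) w i.

Lemma incrP N (s : 'S_N) (A : {set 'I_N}) :
  reflect {in A &, forall i j : 'I_N, i < j -> s i < s j} (incr s A).
Proof.
apply: (iffP forall_inP) => [h i j iA jA|h i iA].
  by move/forall_inP: (h i iA) => /(_ j jA) /implyP.
by apply/forall_inP => j jA; apply/implyP; apply: h.
Qed.

Lemma incr0 N (s : 'S_N) : incr s finset.set0.
Proof. by apply/incrP => i j; rewrite inE. Qed.

Lemma leq_wlis N (s : 'S_N) (w : 'I_N -> nat) A :
  incr s A -> \sum_(i in A) w i <= wlis s w.
Proof. by move=> sA; apply: (leq_bigmax_cond (P := incr s)). Qed.

Lemma wlis_attained N (s : 'S_N) (w : 'I_N -> nat) :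
  exists2 A, incr s A & wlis s w = \sum_(i in A) w i.
Proof.
have [|A sA eA] := @eq_bigmax_cond _ (incr s) (fun A => \sum_(i in A) w i).
  by apply/card_gt0P; exists finset.set0; exact: incr0.
by exists A.
Qed.

(** An increasing list of positions is determined by its set of entries, so
subsequences can be handled as sets. *)
Lemma has_incr_subseqP N (s : 'S_N) k :
  reflect (exists2 A, incr s A & #|A| = k) (has_incr_subseq s k).
Proof.
have ltT : transitive (fun i j : 'I_N => i < j).
  by move=> y x z; apply: ltn_trans.
apply: (iffP existsP) => [[t /andP[]]|[A sA <-]].
  rewrite !(sorted_pairwise ltT) pairwise_map => ht hs.
  have ut : uniq t by apply: (sorted_uniq ltT) => [x|];
    [exact: ltnn | rewrite sorted_pairwise].
  exists [set x in t]; last by rewrite cardsE (card_uniqP ut) size_tuple.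
  apply/incrP => i j; rewrite !inE => it jt ij.
  (* [i] before [j] in [t] gives the claim; the reverse order would contradict
     the sortedness of [t]. *)
  have : (index i t < index j t) || (index j t < index i t).
    rewrite -neq_ltn; apply: contraTneq ij => e.
    by rewrite -(nth_index i it) e nth_index // ltnn.
  have nthP : {in t &, forall x y, index x t < index y t ->
      (x < y) && (s x < s y)}.
    move=> x y xt yt xy.
    move/(pairwiseP i): ht => /(_ _ _ _ _ xy); rewrite !inE !index_mem !nth_index //.
    move/(pairwiseP i): hs => /(_ _ _ _ _ xy); rewrite !inE !index_mem !nth_index //=.
    by move=> -> // ->.
  case/orP => [/(nthP _ _ it jt)/andP[] //|/(nthP _ _ jt it)/andP[ji]].
  by rewrite ltnNge ltnW in ij.
have se : sorted (fun i j : 'I_N => i < j) (enum A).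
  rewrite {1}/enum_mem -enumT; apply: (sorted_filter ltT).
  by have := iota_ltn_sorted 0 N; rewrite -val_enum_ord sorted_map.
exists (Tuple (introT eqP (esym (cardE A)))); rewrite /= se /=.
rewrite sorted_map; apply: (sub_in_sorted (P := mem A)) se; last first.
  by apply/allP => x; rewrite mem_enum.
by move=> i j iA jA; apply: (incrP _ _ sA).
Qed.

Lemma lisE N (s : 'S_N) : lis s = wlis s (fun=> 1).
Proof.
apply/eqP; rewrite eqn_leq; apply/andP; split.
  apply/bigmax_leqP => k /has_incr_subseqP[A sA <-].
  by rewrite -sum1_card leq_wlis.
apply/bigmax_leqP => A sA; rewrite sum1_card.
have ltA : #|A| < N.+1 by rewrite ltnS -[leqRHS]card_ord max_card.
apply: (leq_bigmax_cond (P := fun k : 'I_N.+1 => has_incr_subseq s k)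
  (F := fun k : 'I_N.+1 => k : nat) (Ordinal ltA)).
by apply/has_incr_subseqP; exists A.
Qed.

(** * Block permutations *)

Definition inflate m k (c : 'S_m) (f : 'I_m -> 'S_k) : 'S_(m * k) :=
  (osum f * otens c 1)%g.

Lemma inflateE m k (c : 'S_m) (f : 'I_m -> 'S_k) i j :
  inflate c f (mxtens_index (i, j)) = mxtens_index (c i, f i j).
Proof.
by rewrite permM !permE /osum_fun /otens_fun !mxtens_indexK /= perm1.
Qed.

Lemma ltn_mxtens_index m k (i i' : 'I_m) (j j' : 'I_k) :
  (mxtens_index (i, j) < mxtens_index (i', j')) =
  (i < i') || (i == i') && (j < j').
Proof.
have ltjk := ltn_ord j; have ltjk' := ltn_ord j'.
have shift (a b x y : nat) : a < b -> x < k -> a * k + x < b * k + y.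
  move=> ab xk; apply: (@leq_trans (a.+1 * k)); first by rewrite mulSn addnC ltn_add2r.
  exact: leq_trans (leq_mul ab (leqnn k)) (leq_addr _ _).
rewrite /= -val_eqE /=; case: (ltngtP i i') => [lti|lti|->] /=; last by rewrite ltn_add2l.
  exact: shift.
by apply/negbTE; rewrite -leqNgt ltnW ?shift.
Qed.

Definition block m k (A : {set 'I_(m * k)}) (i : 'I_m) : {set 'I_k} :=
  [set j | mxtens_index (i, j) \in A].

Lemma card_blocks m k (A : {set 'I_(m * k)}) : #|A| = \sum_i #|block A i|.
Proof.
rewrite -sum1_card (reindex (@mxtens_index m k)) /=; last first.
  by exists (@mxtens_unindex m k) => x _; rewrite ?mxtens_indexK ?mxtens_unindexK.
under [RHS]eq_bigr do rewrite -sum1_card.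
rewrite pair_big_dep /=; apply: eq_big => [[i j]|//]; by rewrite inE.
Qed.

(** The blocks met by an increasing set form an increasing set for [c], since
positions are compared lexicographically; conversely, optimal choices inside
the blocks of an increasing set for [c] can be put together. *)
Lemma lis_inflate m k (c : 'S_m) (f : 'I_m -> 'S_k) :
  lis (inflate c f) = wlis c (fun i => lis (f i)).
Proof.
apply/eqP; rewrite eqn_leq; apply/andP; split.
  have [A /incrP cA eA] := wlis_attained (inflate c f) (fun=> 1).
  rewrite lisE eA sum1_card card_blocks.
  pose I := [set i | block A i != finset.set0].
  rewrite (bigID (mem I)) /= [X in _ + X]big1 ?addn0; last first.
    by move=> i; rewrite inE negbK => /eqP ->; rewrite cards0.
  apply: leq_trans (leq_wlis _ (A := I) _) => [|]; last first.
    apply/incrP => i i'; rewrite !inE => /finset.set0Pn[j jA] /finset.set0Pn[j' jA'] lti.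
    rewrite !inE in jA jA'.
    have := cA _ _ jA jA'; rewrite !inflateE !ltn_mxtens_index lti => /(_ isT).
    by case/orP => // /andP[/eqP/perm_inj e]; rewrite e ltnn in lti.
  apply: leq_sum => i _; rewrite lisE -sum1_card leq_wlis //.
  apply/incrP => j j'; rewrite !inE => jA jA' ltj.
  have := cA _ _ jA jA'; rewrite !inflateE !ltn_mxtens_index !eqxx !ltnn ltj.
  exact.
have [I /incrP cI ->] := wlis_attained c (fun i => lis (f i)).
have /fin_all_exists[B fB] i : exists B, incr (f i) B /\ lis (f i) = #|B|.
  have [B fB eB] := wlis_attained (f i) (fun=> 1).
  by exists B; rewrite lisE eB sum1_card.
pose A := [set mxtens_index (i, j) | i in I, j in B i].
have inA i j : (mxtens_index (i, j) \in A) = (i \in I) && (j \in B i).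
  apply/imset2P/andP => [[i' j' iI jB /(can_inj (@mxtens_indexK _ _))[-> ->]] //|].
  by case=> iI jB; exists i j.
have -> : \sum_(i in I) lis (f i) = #|A|.
  rewrite card_blocks [RHS](bigID (mem I)) /= [X in _ + X]big1 ?addn0.
    apply: eq_bigr => i iI; rewrite (fB i).2; apply: eq_card => j.
    by rewrite inE inA iI.
  move=> i /negbTE iI; apply: eq_card0 => j.
  by rewrite inE inA iI.
rewrite lisE -sum1_card leq_wlis //; apply/incrP => x y.
case: (mxtens_indexP x) => i j; case: (mxtens_indexP y) => i' j'.
rewrite !inA => /andP[iI jB] /andP[iI' jB'].
rewrite !inflateE !ltn_mxtens_index => /orP[lti|/andP[/eqP e ltj]].
  by rewrite cI.
subst i'; rewrite eqxx ltnn /=; exact: (incrP _ _ (fB i).1).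
Qed.

Lemma cast_perm_lis N N' (e : N = N') (s : 'S_N) : lis (cast_perm e s) = lis s.
Proof. by subst N'; rewrite cast_perm_id. Qed.

(** * Powers of the cycle *)

Lemma cycX m k (i : 'I_m) : (cyc m ^+ k)%g i = (i + k) %% m :> nat.
Proof.
elim: k => [|k IHk]; first by rewrite expg0 perm1 addn0 modn_small.
by rewrite expgSr permM permE /= IHk -addn1 modnDml addn1 addnS.
Qed.

Lemma cycX_inj m : {in predT &, injective (fun k : 'I_m => (cyc m ^+ k)%g)}.
Proof.
move=> k k' _ _ /permP e; apply: val_inj => /=.
have m0 : 0 < m by apply: leq_trans (ltn_ord k).
by have := congr1 val (e (Ordinal m0)); rewrite /= !cycX /= !add0n !modn_small.
Qed.

Lemma cycle_cyc m : 0 < m -> <[cyc m]>%g = [set (cyc m ^+ k)%g | k : 'I_m].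
Proof.
move=> m0; apply/setP => c; apply/idP/imsetP => [/cycleP[k ->]|[k _ ->]].
  exists (Ordinal (ltn_pmod k m0)) => //; apply/permP => i.
  by apply: val_inj; rewrite /= !cycX /= modnDmr.
exact: mem_cycle.
Qed.

(** These are the positions that the [k]-th power of the cycle shifts without
wrapping around. *)
Definition head_run m k : {set 'I_m} := [set i : 'I_m | i + k < m].

Lemma incr_head_run m k : incr (cyc m ^+ k)%g (head_run m k).
Proof.
apply/incrP => i j; rewrite !inE => ik jk ij.
by rewrite !cycX !modn_small // ltn_add2r.
Qed.

(** A position before the wrap-around is sent above any position after it. *)
Lemma incr_cycX_sub m k (A : {set 'I_m}) : k <= m -> incr (cyc m ^+ k)%g A ->
  A \subset head_run m k \/ A \subset ~: head_run m k.
Proof.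
move=> km /incrP kA.
case: (boolP (A \subset ~: _)) => [|/fintype.subsetPn[j jA] jk];
  [by right|left; move: jk].
rewrite !inE negbK => jk; apply/fintype.subsetP => i iA; rewrite inE ltnNge.
apply/negP => ik; have im := ltn_ord i.
have := kA _ _ jA iA; rewrite !cycX (modn_small jk).
rewrite -(subnK ik) modnDr modn_small; lia.
Qed.

Lemma card_head_run m k : #|head_run m k| = m - k.
Proof.
rewrite -sum1_card -[RHS]card_ord -sum1_card.
rewrite [RHS](big_ord_widen m (fun=> 1)) ?leq_subr //.
by apply: eq_bigl => i; rewrite inE; lia.
Qed.

Lemma card_tail_run m k : k <= m -> #|~: head_run m k| = k.
Proof. by move=> km; rewrite cardsCs finset.setCK card_head_run card_ord subKn. Qed.

(** Cauchy-Schwarz against the constant 1. *)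
Lemma sqr_sum_leq (I : finType) (A : {pred I}) (w : I -> nat) :
  (\sum_(i in A) w i) ^ 2 <= #|A| * \sum_(i in A) w i ^ 2.
Proof.
rewrite -(leq_pmul2l (isT : 0 < 2)).
rewrite expnS expn1 big_distrlr /= big_distrr /=.
under eq_bigr do rewrite big_distrr /=.
apply: (@leq_trans (\sum_(i in A) \sum_(j in A) (w i ^ 2 + w j ^ 2))).
  by apply: leq_sum => i _; apply: leq_sum => j _; rewrite nat_Cauchy.
under eq_bigr do rewrite big_split /= sum_nat_const.
by rewrite big_split /= sum_nat_const -big_distrr /= addnn mul2n.
Qed.

(** The sum of both runs on the right, instead of their maximum, is what
survives taking expectations. *)
Lemma wlis_cycX_sqr m k (w : 'I_m -> nat) : k <= m ->
  wlis (cyc m ^+ k)%g w ^ 2 <=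
  (m - k) * \sum_(i in head_run m k) w i ^ 2 +
  k * \sum_(i in ~: head_run m k) w i ^ 2.
Proof.
move=> km; have [A sA ->] := wlis_attained (cyc m ^+ k)%g w.
have sub (B : {set 'I_m}) : A \subset B ->
    (\sum_(i in A) w i) ^ 2 <= #|B| * \sum_(i in B) w i ^ 2.
  move=> AB; apply: leq_trans (sqr_sum_leq _ _); rewrite leq_sqr.
  by rewrite [leqRHS](big_setID A) /= (finset.setIidPr AB) leq_addr.
have [/sub|/sub] := incr_cycX_sub km sA.
  by rewrite card_head_run => /leq_trans -> //; exact: leq_addr.
by rewrite card_tail_run // => /leq_trans -> //; exact: leq_addl.
Qed.

Lemma sum_head_run_card m : 2 * \sum_(k < m) (m - k) = m * m.+1.
Proof.
elim: m => [|m IHm]; first by rewrite big_ord0.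
by rewrite big_ord_recl subn0 /= mulnDr IHm; lia.
Qed.

Lemma sum_run_card_sqr m :
  3 * \sum_(k < m) ((m - k) ^ 2 + k ^ 2) = m * (2 * m ^ 2 + 1).
Proof.
rewrite big_split /= [X in X + _](reindex_inj rev_ord_inj) /=.
under eq_bigr => k _ do rewrite subKn //.
rewrite -big_split /=; elim: m => [|m IHm]; first by rewrite big_ord0.
by rewrite big_ord_recr /= mulnDr IHm; nia.
Qed.

(** * Uniform means *)

Local Open Scope classical_set_scope.
Local Open Scope ring_scope.

Lemma ler_unif_mean (R : realType) (T : finType) (A : {set T}) (X Y : T -> nat) :
  (forall s, (X s <= Y s)%N) -> unif_mean R A X <= unif_mean R A Y.
Proof.
move=> XY; rewrite /unif_mean ler_wpM2r ?invr_ge0 ?ler0n //.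
by apply: ler_sum => s _; rewrite ler_nat.
Qed.

Lemma unif_meanD (R : realType) (T : finType) (A : {set T}) (X Y : T -> nat) :
  unif_mean R A (fun s => (X s + Y s)%N) = unif_mean R A X + unif_mean R A Y.
Proof.
rewrite /unif_mean -mulrDl -big_split /=; congr (_ / _).
by apply: eq_bigr => s _; rewrite natrD.
Qed.

Lemma unif_meanZ (R : realType) (T : finType) (A : {set T}) a (X : T -> nat) :
  unif_mean R A (fun s => (a * X s)%N) = a%:R * unif_mean R A X.
Proof.
rewrite /unif_mean mulrA mulr_sumr; congr (_ / _).
by apply: eq_bigr => s _; rewrite natrM.
Qed.

Lemma unif_mean_sum (R : realType) (T I : finType) (A : {set T}) (P : {pred I})
    (X : I -> T -> nat) :
  unif_mean R A (fun s => \sum_(i in P) X i s)%N =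
  \sum_(i in P) unif_mean R A (X i).
Proof.
rewrite /unif_mean -mulr_suml exchange_big /=; congr (_ / _).
by apply: eq_bigr => s _; rewrite natr_sum.
Qed.

Lemma sqr_unif_mean_le (R : realType) (T : finType) (A : {set T})
    (X : T -> nat) :
  unif_mean R A X ^+ 2 <= unif_mean R A (fun s => X s ^ 2)%N.
Proof.
rewrite /unif_mean.
have [->|A0] := posnP #|A|; first by rewrite invr0 !mulr0 expr0n.
have A0' : 0 < #|A|%:R :> R by rewrite ltr0n.
rewrite expr_div_n ler_pdivrMr ?exprn_gt0 // expr2 mulrA divfK ?gt_eqF // -expr2 mulrC.
have := sqr_sum_leq (mem A) X; rewrite -(ler_nat R) natrX natrM !natr_sum.
exact.
Qed.

Definition families m (T : finType) (B : {set T}) : {set {ffun 'I_m -> T}} :=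
  [set f | f \in ffun_on (mem B)]%SET.

Lemma card_families m (T : finType) (B : {set T}) : #|families m B| = (#|B| ^ m)%N.
Proof. by rewrite /families cardsE card_ffun_on card_ord. Qed.

(** Each coordinate of a uniform family is itself uniform; by distributivity,
the sum over all families is a product over the coordinates. *)
Lemma unif_mean_coord (R : realType) m (T : finType) (B : {set T}) i
    (X : T -> nat) : (0 < #|B|)%N ->
  unif_mean R (families m B) (fun f => X (f i)) = unif_mean R B X.
Proof.
move=> B0; rewrite /unif_mean card_families.
(* The product over [i'] of [F i' (f i')] isolates the [i]-th coordinate. *)
pose F i' s : R := if i' == i then (X s)%:R else 1.
have prodF (f : 'I_m -> T) : \prod_i' F i' (f i') = (X (f i))%:R.
  rewrite (bigD1 i) //= {1}/F eqxx big1 ?mulr1 // => i' /negbTE ne.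
  by rewrite /F ne.
rewrite (_ : \sum_(f in families m B) _ = \prod_i' \sum_(s in B) F i' s); last first.
  rewrite bigA_distr_big; apply: eq_big => [f|f _]; first by rewrite inE.
  by rewrite prodF.
have m0 : (0 < m)%N by apply: leq_trans (ltn_ord i).
have -> : \prod_i' \sum_(s in B) F i' s =
    (\sum_(s in B) (X s)%:R) * #|B|%:R ^+ m.-1.
  rewrite (bigD1 i) //= {1}/F eqxx; congr (_ * _).
  transitivity (\prod_(i' < m | i' != i) (#|B|%:R : R)); last first.
    by rewrite prodr_const cardC1 card_ord.
  by apply: eq_bigr => i' /negbTE ne; rewrite /F ne sumr_const.
rewrite natrX -[in X in _ / X](prednK m0) exprS /=.
have Bn0 : #|B|%:R != 0 :> R by rewrite pnatr_eq0 -lt0n.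
by rewrite invfM [X in _ * X]mulrC mulrA mulfK // expf_neq0.
Qed.

(** * Uniform elements of the butterfly groups *)

Lemma inflate_inj m k (c c' : 'S_m) (f f' : 'I_m -> 'S_k) : (0 < k)%N ->
  inflate c f = inflate c' f' -> c = c' /\ f =1 f'.
Proof.
move=> k0 /permP e.
have e' i j : (c i, f i j) = (c' i, f' i j).
  by have := e (mxtens_index (i, j)); rewrite !inflateE
    => /(can_inj (@mxtens_indexK _ _)).
split=> [|i]; apply/permP.
  by move=> i; case: (e' i (Ordinal k0)).
by move=> j; case: (e' i j).
Qed.

(** Indexing the rotation by its exponent makes the parametrization
injective, so that a uniform element amounts to a uniform exponent and a
uniform family. *)
Definition butterfly_elt m p (x : 'I_m * {ffun 'I_m -> 'S_(m ^ p)}) : 'S_(m ^ p.+1) :=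
  cast_perm (esym (expnS m p)) (inflate (cyc m ^+ x.1)%g x.2).

Lemma butterfly_elt_inj m p : (0 < m)%N -> injective (@butterfly_elt m p).
Proof.
move=> m0 [k f] [k' f'] /(can_inj (cast_permK _)) /=.
have mp0 : (0 < m ^ p)%N by rewrite expn_gt0 m0.
case/(inflate_inj mp0) => /(cycX_inj isT isT) -> /ffunP -> //.
Qed.

Lemma butterfly_image m n : (0 < m)%N ->
  butterfly m n.+2 =
  [set butterfly_elt x
     | x in finset.setX [set: 'I_m]%SET (families m (butterfly m n.+1))]%SET.
Proof.
move=> m0; rewrite butterflySS; apply/setP => s.
apply/imset2P/imsetP => [[c f]|[[k f]]].
  rewrite cycle_cyc // => /imsetP[k _ ->] fB ->.
  by exists (k, f) => //; rewrite finset.in_setX !inE.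
rewrite finset.in_setX !inE => fB ->.
by exists (cyc m ^+ k)%g f => //; exact: mem_cycle.
Qed.

Lemma butterfly_gt0 m n : (0 < m)%N -> (0 < #|butterfly m n.+1|)%N.
Proof.
move=> m0; elim: n => [|n IHn]; first by rewrite butterfly1 cardG_gt0.
rewrite butterfly_image // card_imset; last exact: butterfly_elt_inj.
by rewrite cardsX cardsT card_ord muln_gt0 m0 card_families expn_gt0 IHn.
Qed.

Lemma unif_mean_butterfly1 (R : realType) m (X : 'S_m -> nat) : (0 < m)%N ->
  unif_mean R (butterfly m 1) X = (\sum_(k < m) X (cyc m ^+ k)%g)%N%:R / m%:R.
Proof.
move=> m0; rewrite butterfly1 /unif_mean cycle_cyc //.
rewrite card_in_imset ?big_imset /=; try exact: cycX_inj.
by rewrite card_ord natr_sum.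
Qed.

Lemma unif_mean_butterflySS (R : realType) m n (X : 'S_(m ^ n.+2) -> nat) :
  (0 < m)%N ->
  unif_mean R (butterfly m n.+2) X =
  (\sum_(k < m)
     unif_mean R (families m (butterfly m n.+1))
       (fun f => X (butterfly_elt (k, f)))) / m%:R.
Proof.
move=> m0; rewrite butterfly_image // /unif_mean.
rewrite card_imset ?big_imset /=; try by
  [exact: butterfly_elt_inj | move=> ? ? _ _; exact: butterfly_elt_inj].
rewrite cardsX cardsT card_ord natrM invfM -[in RHS]mulr_suml pair_big_dep /=.
rewrite [X in _ * X = _]mulrC mulrA; congr (_ / _ / _).
apply: eq_big => [[k f]|[k f] _ //].
by rewrite finset.in_setX inE.
Qed.

Lemma sum_subnR (R : realType) m :
  \sum_(k < m) (m - k)%:R = m%:R * (m.+1%:R / 2) :> R.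
Proof.
rewrite -natr_sum; have /(congr1 (fun a => a%:R : R)) := sum_head_run_card m.
by rewrite !natrM => e; apply: (mulfI (x := 2)); rewrite ?pnatr_eq0 // e; field.
Qed.

Lemma sum_sqr_runR (R : realType) m :
  \sum_(k < m) ((m - k) ^ 2 + k ^ 2)%:R = m%:R * ((2 * m ^ 2 + 1)%:R / 3) :> R.
Proof.
rewrite -natr_sum; have /(congr1 (fun a => a%:R : R)) := sum_run_card_sqr m.
by rewrite !natrM => e; apply: (mulfI (x := 3)); rewrite ?pnatr_eq0 // e; field.
Qed.

(** * Recursions for the first two moments *)

(** Only the first run of blocks is used: [m - k] averages to [(m + 1) / 2]. *)
Lemma mean_lis_ge (R : realType) m n : (0 < m)%N ->
  (m.+1%:R / 2) ^+ n.+1 <= unif_mean R (butterfly m n.+1) (@lis (m ^ n.+1)).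
Proof.
move=> m0; have m0R : 0 < m%:R :> R by rewrite ltr0n.
elim: n => [|n IHn].
  rewrite (@unif_mean_butterfly1 R m (@lis m) m0) ler_pdivlMr // expr1 mulrC.
  rewrite -sum_subnR -natr_sum ler_nat; apply: leq_sum => k _.
  rewrite lisE -card_head_run -sum1_card; apply: leq_wlis.
  exact: incr_head_run.
rewrite unif_mean_butterflySS // ler_pdivlMr // exprS mulrC mulrA -sum_subnR.
rewrite mulr_suml; apply: ler_sum => k _.
apply: le_trans (ler_wpM2l (ler0n _ _) IHn) _.
pose Y (f : {ffun 'I_m -> 'S_(m ^ n.+1)}) :=
  (\sum_(i in head_run m k) lis (f i))%N.
apply: (@le_trans _ _ (unif_mean R (families m (butterfly m n.+1)) Y)).
  rewrite unif_mean_sum -card_head_run mulr_natl -sumr_const.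
  apply: ler_sum => i _; rewrite (unif_mean_coord R i (@lis (m ^ n.+1))) //.
  exact: butterfly_gt0.
apply: ler_unif_mean => f; rewrite /butterfly_elt cast_perm_lis lis_inflate.
exact/leq_wlis/incr_head_run.
Qed.

(** Second moments decouple the two runs, and [(m - k)^2 + k^2] averages to
[(2 m^2 + 1) / 3]. *)
Lemma mean_lis_sqr_le (R : realType) m n : (0 < m)%N ->
  unif_mean R (butterfly m n.+1) (fun s => lis s ^ 2)%N <=
  ((2 * m ^ 2 + 1)%:R / 3) ^+ n.+1.
Proof.
move=> m0; have m0R : 0 < m%:R :> R by rewrite ltr0n.
elim: n => [|n IHn].
  rewrite (@unif_mean_butterfly1 R m (fun s => lis s ^ 2)%N m0) ler_pdivrMr //.
  rewrite expr1 mulrC -sum_sqr_runR -natr_sum ler_nat; apply: leq_sum => k _.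
  rewrite lisE; apply: leq_trans (wlis_cycX_sqr _ _) _; first exact: ltnW.
  by rewrite !sum1_card card_head_run card_tail_run // ltnW.
rewrite unif_mean_butterflySS // ler_pdivrMr // exprS mulrC mulrA -sum_sqr_runR.
rewrite mulr_suml; apply: ler_sum => k _.
apply: le_trans (ler_wpM2l (ler0n _ _) IHn).
have km : (k <= m)%N := ltnW (ltn_ord k).
pose Y (H : {set 'I_m}) (f : {ffun 'I_m -> 'S_(m ^ n.+1)}) :=
  (\sum_(i in H) lis (f i) ^ 2)%N.
apply: (@le_trans _ _ (unif_mean R (families m (butterfly m n.+1))
    (fun f => (m - k) * Y (head_run m k) f + k * Y (~: head_run m k)%SET f)%N)).
  apply: ler_unif_mean => f; rewrite /butterfly_elt cast_perm_lis lis_inflate.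
  exact: wlis_cycX_sqr.
have EY (H : {set 'I_m}) : unif_mean R (families m (butterfly m n.+1)) (Y H) =
    #|H|%:R * unif_mean R (butterfly m n.+1) (fun s => lis s ^ 2)%N.
  rewrite unif_mean_sum mulr_natl -sumr_const; apply: eq_bigr => i _.
  rewrite (unif_mean_coord R i (fun s => lis s ^ 2)%N) //; exact: butterfly_gt0.
rewrite unif_meanD !unif_meanZ !EY card_head_run card_tail_run //.
by rewrite natrD !natrX !expr2 mulrDl !mulrA.
Qed.

(** * The exponents *)

Lemma powR_log (R : realType) (a b : R) : 1 < a -> 0 < b ->
  a `^ (ln b / ln a) = b.
Proof.
move=> a1 b0; have a0 : 0 < a := lt_trans ltr01 a1.
by rewrite /powR gt_eqF // divfK ?lnK // gt_eqF // ln_gt0.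
Qed.

Lemma powR_natX (R : realType) (m n : nat) (x : R) :
  (m ^ n)%:R `^ x = (m%:R `^ x) ^+ n :> R.
Proof.
by rewrite natrX -powR_mulrn // -powRrM mulrC powRrM powR_mulrn // powR_ge0.
Qed.

Definition lower_exp (R : realType) (m : nat) : R := ln (m.+1%:R / 2) / ln m%:R.
Definition upper_exp (R : realType) (m : nat) : R :=
  ln ((2 * m ^ 2 + 1)%:R / 3) / (2 * ln m%:R).

Lemma ln_nat_gt0 (R : realType) (m : nat) : (2 <= m)%N -> 0 < ln m%:R :> R.
Proof. by move=> m2; rewrite ln_gt0 // ltr1n. Qed.

Lemma ln_sqr (R : realType) (x : R) : 0 < x -> ln (x ^+ 2) = 2 * ln x.
Proof. by move=> x0; rewrite lnXn // mulr_natl. Qed.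

(** Equivalent to [4 m < (m + 1)^2]. *)
Lemma lower_exp_gt (R : realType) (m : nat) : (2 <= m)%N -> 2^-1 < lower_exp R m.
Proof.
move=> m2; rewrite /lower_exp ltr_pdivlMr ?ln_nat_gt0 //.
rewrite mulrC ltr_pdivrMr // mulrC -ln_sqr ?divr_gt0 ?ltr0n //.
rewrite ltr_ln ?posrE ?exprn_gt0 ?divr_gt0 ?ltr0n //; last exact: ltnW.
have : 2 <= m%:R :> R by rewrite ler_nat.
rewrite -[m.+1%:R]natr1; nra.
Qed.

(** Equivalent to [3 (m + 1)^2 < 4 (2 m^2 + 1)], which factors as
[0 < (5 m - 1) (m - 1)]. *)
Lemma lower_lt_upper_exp (R : realType) (m : nat) : (2 <= m)%N ->
  lower_exp R m < upper_exp R m.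
Proof.
move=> m2; have l0 := ln_nat_gt0 R m2.
rewrite /lower_exp /upper_exp invfM mulrA ltr_pM2r ?invr_gt0 //.
rewrite ltr_pdivlMr // mulrC -ln_sqr ?divr_gt0 ?ltr0n //.
rewrite ltr_ln ?posrE ?exprn_gt0 ?divr_gt0 ?ltr0n //; last by lia.
have : 2 <= m%:R :> R by rewrite ler_nat.
rewrite -[m.+1%:R]natr1 natrD natrM natrX; nra.
Qed.

Lemma upper_exp_lt1 (R : realType) (m : nat) : (2 <= m)%N -> upper_exp R m < 1.
Proof.
move=> m2; have l0 := ln_nat_gt0 R m2.
rewrite /upper_exp ltr_pdivrMr ?mulr_gt0 // mul1r -ln_sqr ?ltr0n; last by lia.
rewrite ltr_ln ?posrE ?exprn_gt0 ?divr_gt0 ?ltr0n //; try by lia.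
have : 2 <= m%:R :> R by rewrite ler_nat.
rewrite natrD natrM natrX; nra.
Qed.

(** Replacing [m + 1] by [m] in the numerator bounds the distance to 1 by
[ln 2 / ln m]. *)
Lemma lower_exp_cvg (R : realType) : lower_exp R @ \oo --> (1 : R).
Proof.
apply/cvgrPdist_lt => e e0; near=> m.
have m2 : (2 <= m)%N by near: m; exact: nbhs_infty_ge.
have l0 := ln_nat_gt0 R m2.
have lt1 : lower_exp R m <= 1.
  by apply: ltW; apply: lt_trans (lower_lt_upper_exp R m2) (upper_exp_lt1 R m2).
rewrite ger0_norm ?subr_ge0 // ltrBlDl -ltrBlDr.
rewrite /lower_exp ltr_pdivlMr // mulrBl mul1r.
apply: (@lt_le_trans _ _ (ln m%:R - ln 2)); last first.
  rewrite -ln_div ?posrE ?ltr0n //; last by lia.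
  rewrite ler_ln ?posrE ?divr_gt0 ?ltr0n //; last by lia.
  by rewrite ler_pM2r // ler_nat.
rewrite ltrD2l ltrN2 mulrC -ltr_pdivrMr //.
rewrite -(expRK (ln 2 / e)) ltr_ln ?posrE ?expR_gt0 ?ltr0n //; last by lia.
by near: m; exact: nbhs_infty_gtr.
Unshelve. all: by end_near. Qed.

Theorem theorem8 (R : realType) :
  exists alpha beta : nat -> R,
    (forall m : nat, (2 <= m)%N ->
       [/\ 2^-1 < alpha m, alpha m < beta m, beta m < 1 &
           forall n : nat, (1 <= n)%N ->
             let N : R := (m ^ n)%:R in
             let EL : R := unif_mean R (butterfly m n) (@lis (m ^ n)) in
             N `^ alpha m <= EL /\ EL <= N `^ beta m])
    /\ (alpha @ \oo --> (1 : R)).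
Proof.
exists (lower_exp R), (upper_exp R); split; last exact: lower_exp_cvg.
move=> m m2; have m0 : (0 < m)%N by exact: ltnW.
split; [exact: lower_exp_gt|exact: lower_lt_upper_exp|exact: upper_exp_lt1|].
have m1 : 1 < m%:R :> R by rewrite ltr1n.
case=> [//|n] _ N EL; rewrite /N !powR_natX; split.
  by rewrite powR_log ?divr_gt0 ?ltr0n // mean_lis_ge.
have b0 : 0 < (2 * m ^ 2 + 1)%:R / 3 :> R by rewrite divr_gt0 ?ltr0n //; lia.
rewrite -ler_sqr ?nnegrE ?exprn_ge0 ?powR_ge0 //; last first.
  by rewrite divr_ge0 ?sumr_ge0.
apply: le_trans (sqr_unif_mean_le _ _ _) _.
apply: le_trans (mean_lis_sqr_le _ _ m0) _.
rewrite exprAC -(powR_mulrn 2) ?powR_ge0 // -powRrM.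
have -> : upper_exp R m * 2 = ln ((2 * m ^ 2 + 1)%:R / 3) / ln m%:R.
  by rewrite /upper_exp; field; rewrite gt_eqF // ln_gt0.
by rewrite powR_log.
Qed.
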